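(* Let $\{\mathcal{R}_A\}$ be a zero-divisor functorial family with associated zero-divisor functor $\zeta$. Let $A,B_1,B_2$ be rings such that $\zeta(A)\simeq\zeta(B_1)\times\zeta(B_2)$, with $\zeta(B_1),\zeta(B_2)\not\simeq\zeta(\mathbf{0})$. Then: 1. there exist $a_1,a_2\in A$ such that i) $a_1\perp a_2$ and $a_1,a_2\in\mathcal{D}^*(A)$; ii) $\zeta(B_1)\simeq\zeta(\operatorname{Ann}(a_2))$ and $\zeta(B_2)\simeq\zeta(\operatorname{Ann}(a_1))$; iii) there exist strong graph morphisms $\psi_i:\zeta(B_i)\to\zeta(A/\operatorname{Ann}(a_i))$, for $i=1,2$; and these $a_1,a_2,\psi_1,\psi_2$ can be taken so that the following also hold: 2. for $i,j\in\{1,2\}$ with $i\neq j$: if $\bar x\,\mathcal{R}_{A/\operatorname{Ann}(a_i)}\,\bar x'$ implies $x\,\mathcal{R}_A\,x'$ for all $x,x'\in\operatorname{Ann}(a_j)$, then $\psi_i$ is injective; 3. if $\operatorname{Ann}(a_1)+\operatorname{Ann}(a_2)=(1)$, then $A\simeq A/\operatorname{Ann}(a_1)\times A/\operatorname{Ann}(a_2)$ and $\psi_1,\psi_2$ are surjective.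
   Context: All rings are commutative and unitary and homomorphisms preserve $1$; $\mathbf{0}$ is the zero ring. A graph is a set $V$ with a symmetric binary relation $E$ on $V$ (loops allowed). A graph morphism is a map on vertices sending adjacent pairs to adjacent pairs; it is strong if moreover two vertices are adjacent whenever their images are; $\simeq$ denotes isomorphism (of graphs or of rings). The product $G_1\times G_2$ of graphs has vertex set $V(G_1)\times V(G_2)$, with two pairs adjacent iff both components are adjacent. An equivalence relation $\mathcal{R}$ on a ring $A$ is a zero-divisor relation if, whenever $a\,\mathcal{R}\,a'$ and $b\,\mathcal{R}\,b'$, $ab=0$ implies $a'b'=0$. A zero-divisor functorial family $\{\mathcal{R}_A\}$ is a choice, for each ring $A$, of a zero-divisor relation $\mathcal{R}_A$ on $A$ such that for every ring homomorphism $f:A\to B$, $a\,\mathcal{R}_A\,a'$ implies $f(a)\,\mathcal{R}_B\,f(a')$. Its associated zero-divisor functor $\zeta$ sends $A$ to the graph $\zeta(A)$ with vertex set $A/\mathcal{R}_A$ in which $[a],[b]$ are adjacent iff $ab=0$, and sends $f:A\to B$ to $\zeta(f):[a]\mapsto[f(a)]$. For a subset $X\subseteq A$, $\zeta(X)$ denotes the subgraph of $\zeta(A)$ induced by $\{[a]:a\in X\}$; in particular $\zeta(\operatorname{Ann}(a_i))$ is such an induced subgraph of $\zeta(A)$. $\operatorname{Ann}(a)=\{c\in A: ca=0\}$. $\mathcal{D}^*(A)$ is the set of nonzero zero-divisors of $A$. Two elements $a,b\in A$ are orthogonal, written $a\perp b$, if $ab=0$ and $\operatorname{Ann}(a)\cap\operatorname{Ann}(b)=0$.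 $\bar x$ denotes the class of $x$ in the relevant quotient ring. *)

(* Defs.v *)
From Corelib Require Import RelationClasses.
From HB Require Import structures.
From mathcomp Require Import all_boot all_order all_algebra.
From mathcomp Require Import generic_quotient ring_quotient.
From mathcomp Require Import boolp classical_sets functions.

Set Implicit Arguments.
Unset Strict Implicit.
Unset Printing Implicit Defensive.

Import GRing.Theory.
Local Open Scope ring_scope.
Local Open Scope quotient_scope.

(* Rings are [comPzRingType]s: unlike [comNzRingType], this class does not
   require 1 != 0, so it contains the zero ring. *)

Record graph := Graph {
  vertex :> Type;
  adj : vertex -> vertex -> Prop;
  adj_sym : forall x y, adj x y -> adj y x }.

Definition graph_morphism (G H : graph) (f : G -> H) : Prop :=
  forall x y, adj x y -> adj (f x) (f y).

Definition strong_graph_morphism (G H : graph) (f : G -> H) : Prop :=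
  graph_morphism f /\ forall x y, adj (f x) (f y) -> adj x y.

Definition graph_iso (G H : graph) : Prop :=
  exists (f : G -> H) (g : H -> G),
    [/\ cancel f g, cancel g f, graph_morphism f & graph_morphism g].

Definition ring_iso (A B : comPzRingType) : Prop :=
  exists f : {rmorphism A -> B}, bijective f.

Section GraphConstructions.
Variables G H : graph.

Definition prod_adj (x y : G * H) : Prop := adj x.1 y.1 /\ adj x.2 y.2.

Lemma prod_adj_sym x y : prod_adj x y -> prod_adj y x.
Proof. by case=> h1 h2; split; apply: adj_sym. Qed.

Definition prod_graph : graph := Graph prod_adj_sym.

Variable X : set G.

Definition induced_adj (x y : {v : G | X v}) : Prop := adj (sval x) (sval y).

Lemma induced_adj_sym x y : induced_adj x y -> induced_adj y x.
Proof. exact: adj_sym. Qed.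

Definition induced_graph : graph := Graph induced_adj_sym.

End GraphConstructions.

Definition zero_ring : Type := unit.

HB.instance Definition _ := Choice.on zero_ring.

Section ZeroRing.
Let add (_ _ : zero_ring) : zero_ring := tt.
Let opp (_ : zero_ring) : zero_ring := tt.

Fact zero_addA : associative add. Proof. by []. Qed.
Fact zero_addC : commutative add. Proof. by []. Qed.
Fact zero_add0 : left_id (tt : zero_ring) add. Proof. by case. Qed.
Fact zero_addN : left_inverse (tt : zero_ring) opp add. Proof. by []. Qed.

HB.instance Definition _ :=
  GRing.isZmodule.Build zero_ring zero_addA zero_addC zero_add0 zero_addN.

Fact zero_mulDl : left_distributive add (+%R : zero_ring -> _).
Proof. by []. Qed.

HB.instance Definition _ := GRing.Zmodule_isComPzRing.Build zero_ring
  zero_addA zero_addC zero_add0 zero_mulDl.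
End ZeroRing.

Section Annihilator.
Variable A : comPzRingType.
Implicit Types (a b c x y : A) (I J : {pred A}).

Definition ann a : {pred A} := [pred c | c * a == 0].

Lemma annE a c : (c \in ann a) = (c * a == 0).
Proof. by []. Qed.

Lemma ann_zmod_closed a : zmod_closed (ann a).
Proof.
split=> [|x y]; rewrite !annE ?mul0r // => /eqP xa0 /eqP ya0.
by rewrite mulrBl xa0 ya0 subrr.
Qed.

HB.instance Definition _ a := GRing.isZmodClosed.Build A (ann a)
  (ann_zmod_closed a).

Lemma ann_mull a c x : x \in ann a -> c * x \in ann a.
Proof. by rewrite !annE -mulrA => /eqP->; rewrite mulr0. Qed.

Definition zero_divisor a : Prop := exists2 b, b != 0 & a * b = 0.

(* The set D*(A). *)
Definition nz_zero_divisor a : Prop := a != 0 /\ zero_divisor a.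

Definition orth a b : Prop :=
  a * b = 0 /\ forall c, c \in ann a -> c \in ann b -> c = 0.

Definition ideal_sum I J : set A :=
  [set z | exists x y, [/\ x \in I, y \in J & z = x + y]].

Definition principal_ideal a : set A := [set z | exists c, z = c * a].

End Annihilator.

(* The quotient ring A / Ann(a).  The library's [{ideal_quot _}] supplies the
   additive group; its multiplication is only available for proper ideals of
   nonzero rings, whereas here Ann(a) = A when a = 0. *)
Section AnnQuotient.
Variables (A : comPzRingType) (a : A).

Definition ann_quot : Type := {ideal_quot (ann a)}.

HB.instance Definition _ := GRing.Zmodule.on ann_quot.
HB.instance Definition _ : EqQuotient A (Quotient.equiv (ann a)) ann_quot :=
  EqQuotient.copy ann_quot {ideal_quot (ann a)}.

Definition ann_proj (x : A) : ann_quot := \pi_ann_quot x.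

Lemma ann_reprK : cancel (@repr _ ann_quot) ann_proj.
Proof. exact: reprK. Qed.

Lemma ann_quot_eqP x y : reflect (ann_proj x = ann_proj y) (x - y \in ann a).
Proof. by rewrite Quotient.idealrBE; apply: eqP. Qed.

Definition ann_quot_one : ann_quot := ann_proj 1.
Definition ann_quot_mul := lift_op2 ann_quot ( *%R : A -> A -> A).

Lemma ann_projM x y : ann_quot_mul (ann_proj x) (ann_proj y) = ann_proj (x * y).
Proof.
rewrite /ann_proj; unlock ann_quot_mul.
rewrite -!/(ann_proj _).
have rx z : repr (ann_proj z) - z \in ann a by apply/ann_quot_eqP; rewrite ann_reprK.
apply/ann_quot_eqP; rewrite -(subrKA (x * repr (ann_proj y))) -mulrBl -mulrBr.
by rewrite rpredD //; last (by rewrite ann_mull); rewrite mulrC ann_mull.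
Qed.

Lemma ann_projB : zmod_morphism ann_proj.
Proof. exact: (@pi_is_zmod_morphism _ _ _ {ideal_quot (ann a)}). Qed.

Lemma ann_quot_mulA : associative ann_quot_mul.
Proof.
by move=> x y z; rewrite -[x]ann_reprK -[y]ann_reprK -[z]ann_reprK !ann_projM mulrA.
Qed.

Lemma ann_quot_mulC : commutative ann_quot_mul.
Proof. by move=> x y; rewrite -[x]ann_reprK -[y]ann_reprK !ann_projM mulrC. Qed.

Lemma ann_quot_mul1 : left_id ann_quot_one ann_quot_mul.
Proof. by move=> x; rewrite -[x]ann_reprK ann_projM mul1r. Qed.

HB.instance Definition _ := GRing.isZmodMorphism.Build A ann_quot ann_proj
  ann_projB.

Lemma ann_quot_mulDl : left_distributive ann_quot_mul +%R.
Proof.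
move=> x y z; rewrite -[x]ann_reprK -[y]ann_reprK -[z]ann_reprK.
by rewrite -raddfD !ann_projM mulrDl raddfD.
Qed.

HB.instance Definition _ := GRing.Zmodule_isComPzRing.Build ann_quot
  ann_quot_mulA ann_quot_mulC ann_quot_mul1 ann_quot_mulDl.

Lemma ann_proj_monoid : monoid_morphism ann_proj.
Proof. by split=> // x y; rewrite -ann_projM. Qed.

HB.instance Definition _ := GRing.isMonoidMorphism.Build A ann_quot ann_proj
  ann_proj_monoid.

End AnnQuotient.

Definition zero_divisor_relation (A : comPzRingType) (R : A -> A -> Prop) :=
  Equivalence R /\
  forall a a' b b', R a a' -> R b b' -> a * b = 0 -> a' * b' = 0.

Record zd_family := ZdFamily {
  zd_rel :> forall A : comPzRingType, A -> A -> Prop;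
  zd_relP : forall A, zero_divisor_relation (@zd_rel A);
  zd_functorial : forall (A B : comPzRingType) (f : {rmorphism A -> B}) a a',
    zd_rel a a' -> zd_rel (f a) (f a') }.

Arguments zd_rel R A _ _ : rename.

Section Zeta.
Variables (R : zd_family) (A : comPzRingType).

Definition zd_relb : rel A := fun a a' => `[< R A a a' >].

Lemma zd_relb_equiv : equiv_class_of zd_relb.
Proof.
have [[rxx rC rT] _] := zd_relP R A; split.
- by move=> x; apply/asboolP.
- by move=> x y; apply/asboolP/asboolP; apply: rC.
- by move=> y x z /asboolP xy /asboolP yz; apply/asboolP; apply: rT xy yz.
Qed.

Canonical zd_equiv := EquivRelPack zd_relb_equiv.

Definition zeta_vertex : Type := {eq_quot zd_equiv}.

Definition zeta_class (a : A) : zeta_vertex := \pi_({eq_quot zd_equiv}) a.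

Lemma zeta_class_eq a b : zeta_class a = zeta_class b <-> R A a b.
Proof.
split=> [/eqP|ab]; first by rewrite piE => /asboolP.
by apply/eqP; rewrite piE; apply/asboolP.
Qed.

Definition zeta_adj (u v : zeta_vertex) : Prop :=
  exists a b, [/\ u = zeta_class a, v = zeta_class b & a * b = 0].

Lemma zeta_adj_sym u v : zeta_adj u v -> zeta_adj v u.
Proof. by case=> a [b] [-> -> ab0]; exists b, a; rewrite mulrC. Qed.

Definition zeta : graph := Graph zeta_adj_sym.

Lemma zeta_adjE a b :
  @adj zeta (zeta_class a) (zeta_class b) <-> a * b = 0.
Proof.
split=> [[a' [b' [/esym/zeta_class_eq aa' /esym/zeta_class_eq bb']]]|ab0].
  exact: (zd_relP R A).2.
by exists a, b.
Qed.

Definition zeta_sub (X : {pred A}) : graph :=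
  induced_graph [set v : zeta | exists2 a, a \in X & v = zeta_class a].

End Zeta.

(* Main.v *)
Require Import Defs.
From HB Require Import structures.
From mathcomp Require Import all_boot all_order all_algebra.
From mathcomp Require Import generic_quotient ring_quotient.
From mathcomp Require Import boolp classical_sets functions.
From mathcomp Require Import unstable.

Set Implicit Arguments.
Unset Strict Implicit.
Unset Printing Implicit Defensive.

Import GRing.Theory.
Local Open Scope ring_scope.

(** The graph isomorphism f : zeta A -> zeta B1 x zeta B2 lets the ring A see
    the two factors.  In each graph [0] is adjacent to every vertex and is the
    only vertex adjacent to [1], so the vertices ([1], [0]) and ([0], [1]) of the product pull
    back to elements a1, a2 of A whose annihilators are read off coordinates:
    c * a1 = 0 exactly when f [c] has first coordinate [0], and c * a2 = 0
    exactly when its second coordinate is [0] ([ann_coord2]).  Orthogonality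
    follows at once, and b |-> f^-1 (b, [0]) identifies zeta B1 with the
    subgraph of the classes of Ann a2; symmetrically for B2.

    The rest is independent of the product.  Let j be a strong embedding of a
    graph G into zeta A with image the classes of Ann a2, and let psi be j
    followed by the map that the projection A -> A / Ann a1 induces.  Elements
    of Ann a2 are multiplied inside Ann a2, which meets Ann a1 in 0, so no
    product becomes zero in the quotient unless it was zero already: psi is
    strong ([strong_annihilator_proj]).  If moreover Ann a1 + Ann a2 = A, every
    class of A / Ann a1 has a representative in Ann a2, so psi is onto, and the
    Chinese remainder theorem splits A ([annihilator_crt]). *)

(** * Graphs *)

Lemma graph_iso_induced (G H : graph) (X : set H) (j : G -> H) :
    strong_graph_morphism j -> injective j -> (forall v, X v <-> exists u, v = j u) ->
  graph_iso G (induced_graph X).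
Proof.
move=> [j_mor j_str] j_inj imj.
have jX u : X (j u) by apply/imj; exists u.
have /choice[h hK] (v : {v | X v}) : exists u, sval v = j u.
  by apply/imj; exact: svalP.
exists (fun u => exist _ (j u) (jX u)), h; split.
- by move=> u; apply: j_inj; rewrite -hK.
- move=> v; apply: eq_sig_hprop => [? ? ?|]; first exact: Prop_irrelevance.
  by rewrite /= -hK.
- by move=> u u' /j_mor.
- by move=> v v'; rewrite /= /induced_adj !hK => /j_str.
Qed.

Lemma graph_iso_adjE (G H : graph) (f : G -> H) (g : H -> G) :
    cancel f g -> graph_morphism f -> graph_morphism g ->
  forall x y, adj (f x) (f y) <-> adj x y.
Proof. by move=> fK fM gM x y; split=> [/gM|/fM//]; rewrite !fK. Qed.

(** * Vertices of zero-divisor graphs *)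

Section ZetaVertices.
Variables (R : zd_family) (A : comPzRingType).

Lemma zeta_classP (v : zeta R A) : exists a, v = zeta_class R a.
Proof. by exists (repr v); rewrite /zeta_class reprK. Qed.

Lemma zeta_adj0 (v : zeta R A) : adj v (zeta_class R 0).
Proof. by case: (zeta_classP v) => a ->; apply/zeta_adjE; rewrite mulr0. Qed.

Lemma zeta_adj1 (v : zeta R A) : adj v (zeta_class R 1) <-> v = zeta_class R 0.
Proof.
split=> [|->]; last exact/adj_sym/zeta_adj0.
by case: (zeta_classP v) => a ->; rewrite zeta_adjE mulr1 => ->.
Qed.

(** Multiplying by 1 shows that a zero-divisor relation isolates 0. *)
Lemma zeta_class_eq0 (a : A) : zeta_class R a = zeta_class R 0 <-> a = 0.
Proof. by rewrite -zeta_adj1 zeta_adjE mulr1. Qed.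

Lemma zeta_trivial_class : 1 = 0 :> A -> forall v : zeta R A, v = zeta_class R 0.
Proof. by move=> A0 v; rewrite -zeta_adj1 A0; exact: zeta_adj0. Qed.

End ZetaVertices.

(** Turns the hypotheses on the graphs of B1 and B2 into 1 != 0 in these rings. *)
Lemma zeta_trivial (R : zd_family) (A : comPzRingType) :
  1 = 0 :> A -> graph_iso (zeta R A) (zeta R zero_ring).
Proof.
move=> A0; exists (fun=> zeta_class R 0), (fun=> zeta_class R 0); split.
- by move=> v; rewrite [RHS]zeta_trivial_class.
- by move=> v; rewrite [RHS]zeta_trivial_class.
- by move=> *; apply: zeta_adj0.
- by move=> *; apply: zeta_adj0.
Qed.

(** Functoriality of the family makes the choice of representative immaterial,
    see [zeta_mapE]. *)
Definition zeta_map (R : zd_family) (A B : comPzRingType) (f : {rmorphism A -> B})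
    (v : zeta R A) : zeta R B :=
  zeta_class R (f (repr v)).

Lemma zeta_mapE (R : zd_family) (A B : comPzRingType) (f : {rmorphism A -> B}) a :
  zeta_map f (zeta_class R a) = zeta_class R (f a).
Proof.
apply/zeta_class_eq/zd_functorial/zeta_class_eq.
by rewrite /zeta_class reprK.
Qed.

(** * Two annihilators with zero intersection *)

Section Annihilators.
Variables (A : comPzRingType) (a1 a2 : A).
Hypothesis ann12 : forall c, c \in ann a1 -> c \in ann a2 -> c = 0.

Lemma ann_proj_eq0 (a x : A) : ann_proj a x = 0 <-> x \in ann a.
Proof.
rewrite -[x in x \in _]subr0 -(raddf0 (ann_proj a)).
by split=> /ann_quot_eqP.
Qed.

Lemma ann_proj_lift (a e x : A) :
  1 - e \in ann a -> ann_proj a (x * e) = ann_proj a x.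
Proof.
move=> ea; apply/esym/ann_quot_eqP.
by rewrite -{1}[x]mulr1 -mulrBr ann_mull.
Qed.

Lemma comaximal_ann_split :
    ideal_sum (ann a1) (ann a2) = principal_ideal (1 : A) ->
  exists2 e, e \in ann a2 & 1 - e \in ann a1.
Proof.
move=> sum1; have : principal_ideal (1 : A) 1 by exists 1; rewrite mulr1.
by rewrite -sum1 => -[x [e [xa ea ->]]]; exists e; rewrite ?addrK.
Qed.

(** The element e of [comaximal_ann_split] is 1 modulo Ann a1 and 0 modulo
    Ann a2, so (x, y) lifts to x * e + y * (1 - e); the lift is unique because
    the two annihilators meet in 0. *)
Lemma annihilator_crt :
    ideal_sum (ann a1) (ann a2) = principal_ideal (1 : A) ->
  ring_iso A (ann_quot a1 * ann_quot a2)%type.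
Proof.
move=> /comaximal_ann_split[e ea2 ea1].
pose F x := (ann_proj a1 x, ann_proj a2 x).
have FB : zmod_morphism F by move=> x y; rewrite /F !raddfB.
have FM : monoid_morphism F by split=> [|x y]; rewrite /F ?rmorph1 ?rmorphM.
pose Fa := GRing.isZmodMorphism.Build _ _ F FB.
pose Fm := GRing.isMonoidMorphism.Build _ _ F FM.
pose Fr : {rmorphism A -> _} := HB.pack F Fa Fm.
have F_inj : injective F.
  move=> x y [/ann_quot_eqP xy1 /ann_quot_eqP xy2].
  by apply/eqP; rewrite -subr_eq0; apply/eqP/ann12.
pose lift (p : ann_quot a1 * ann_quot a2) :=
  repr p.1 * e + repr p.2 * (1 - e).
have liftK : cancel lift F.
  have e2 : 1 - (1 - e) \in ann a2 by rewrite subKr.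
  case=> p q; rewrite /F /lift /= !raddfD /=; congr pair.
    rewrite ann_proj_lift // [X in _ + X](ann_proj_eq0 _ _).2 ?ann_mull //.
    by rewrite addr0 ann_reprK.
  rewrite (ann_proj_lift _ e2) [X in X + _](ann_proj_eq0 _ _).2 ?ann_mull //.
  by rewrite add0r ann_reprK.
by exists Fr; exists lift => // x; apply: F_inj; rewrite liftK.
Qed.

Variables (R : zd_family) (G : graph) (j : G -> zeta R A).
Hypotheses (j_strong : strong_graph_morphism j) (j_inj : injective j).
Hypothesis imj : forall x, x \in ann a2 <-> exists u, zeta_class R x = j u.

(** The first annihilator is the one divided by; the classes of elements of the
    second are the image of j, so that every value has a representative there. *)
Definition annihilator_proj (u : G) : zeta R (ann_quot a1) :=
  zeta_map (ann_proj a1) (j u).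

Lemma annihilator_proj_ann2P u : exists2 x, x \in ann a2 &
  j u = zeta_class R x /\ annihilator_proj u = zeta_class R (ann_proj a1 x).
Proof.
have [x jux] := zeta_classP (j u); exists x; first by apply/imj; exists u.
by rewrite /annihilator_proj jux zeta_mapE.
Qed.

Lemma graph_iso_ann : graph_iso G (zeta_sub R (ann a2)).
Proof.
apply: (graph_iso_induced j_strong j_inj) => v; split=> [[x xa ->]|[u ->]].
  exact/imj.
by have [x xa [-> _]] := annihilator_proj_ann2P u; exists x.
Qed.

(** The product of two elements of Ann a2 stays in Ann a2; if it dies modulo
    Ann a1 it lies in the intersection, hence is 0. *)
Lemma strong_annihilator_proj : strong_graph_morphism annihilator_proj.
Proof.
suff adjE u v : adj (annihilator_proj u) (annihilator_proj v) <-> adj (j u) (j v).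
  by split=> u v => [/j_strong.1/adjE | /adjE/j_strong.2].
have [[x xa [-> ->]] [y ya [-> ->]]] := (annihilator_proj_ann2P u, annihilator_proj_ann2P v).
rewrite !zeta_adjE -rmorphM ann_proj_eq0; split=> [xya|->]; last exact: rpred0.
by apply: ann12; rewrite // ann_mull.
Qed.

Lemma injective_annihilator_proj :
    (forall x x', x \in ann a2 -> x' \in ann a2 ->
      R (ann_quot a1) (ann_proj a1 x) (ann_proj a1 x') -> R A x x') ->
  injective annihilator_proj.
Proof.
move=> reflR u v.
have [[x xa [ju ->]] [y ya [jv ->]]] := (annihilator_proj_ann2P u, annihilator_proj_ann2P v).
move=> /zeta_class_eq /(reflR _ _ xa ya) xy; apply: j_inj.
by rewrite ju jv; apply/zeta_class_eq.
Qed.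

(** With e as in [comaximal_ann_split], multiplying by e moves any
    representative into Ann a2 without changing its class modulo Ann a1. *)
Lemma surjective_annihilator_proj :
    ideal_sum (ann a1) (ann a2) = principal_ideal (1 : A) ->
  set_surj setT setT annihilator_proj.
Proof.
move=> /comaximal_ann_split[e ea2 ea1] w _.
have [y ->] := zeta_classP w; rewrite -[y]ann_reprK.
have /imj[u ju] : repr y * e \in ann a2 by rewrite ann_mull.
by exists u; rewrite // /annihilator_proj -ju zeta_mapE /= ann_proj_lift.
Qed.

End Annihilators.

(** * Graph isomorphisms onto a product *)

Section ProductIso.
Variables (R : zd_family) (A B1 B2 : comPzRingType).
Variables (f : zeta R A -> zeta R B1 * zeta R B2)
          (g : zeta R B1 * zeta R B2 -> zeta R A).
Hypotheses (fK : cancel f g) (gK : cancel g f).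
Hypothesis adj_f : forall x y, adj x y <-> prod_adj (f x) (f y).

(** [0] is adjacent to every vertex and [1] only to [0], so adjacency to
    ([0], [1]) in the product tests the second coordinate alone. *)
Lemma ann_coord2 (a2 c : A) :
    zeta_class R a2 = g (zeta_class R 0, zeta_class R 1) ->
  c \in ann a2 <-> (f (zeta_class R c)).2 = zeta_class R 0.
Proof.
move=> ga2; rewrite -zeta_adj1; split=> [/eqP|c2].
  by rewrite -(zeta_adjE R) adj_f ga2 gK => -[].
apply/eqP/(zeta_adjE R); rewrite adj_f ga2 gK.
by split=> //; exact: zeta_adj0.
Qed.

Lemma coord_eq0 (c : A) :
    (f (zeta_class R c)).1 = zeta_class R 0 ->
    (f (zeta_class R c)).2 = zeta_class R 0 ->
  c = 0.
Proof.
move=> c1 c2; apply/(zeta_class_eq0 R); rewrite -zeta_adj1 adj_f.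
by split; rewrite ?c1 ?c2; apply/adj_sym/zeta_adj0.
Qed.

Definition axis1 (b : zeta R B1) : zeta R A := g (b, zeta_class R 0).

Lemma axis1_inj : injective axis1.
Proof. by move=> b b' /(can_inj gK)[]. Qed.

Lemma strong_axis1 : strong_graph_morphism axis1.
Proof.
split=> b b'; rewrite adj_f !gK; last by case.
by move=> bb'; split=> //; exact: zeta_adj0.
Qed.

Lemma ann_axis1 (a2 c : A) :
    zeta_class R a2 = g (zeta_class R 0, zeta_class R 1) ->
  c \in ann a2 <-> exists b, zeta_class R c = axis1 b.
Proof.
move=> /ann_coord2->; split=> [c2|[b ->]]; last by rewrite gK.
by exists (f (zeta_class R c)).1; rewrite /axis1 -c2 -surjective_pairing fK.
Qed.

(** If a2 were 0 it would annihilate itself, so its second coordinate [1] would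
    equal [0] and B2 would be the zero ring. *)
Lemma unit_coord2_neq0 (a2 : A) :
    ~ graph_iso (zeta R B2) (zeta R zero_ring) ->
    zeta_class R a2 = g (zeta_class R 0, zeta_class R 1) ->
  a2 != 0.
Proof.
move=> B2nz ga2; apply/eqP => a20; apply: B2nz; apply/zeta_trivial/(zeta_class_eq0 R).
have : a2 \in ann a2 by rewrite annE a20 mulr0.
by move=> /(ann_coord2 _ ga2); rewrite ga2 gK.
Qed.

End ProductIso.

(** * Ring elements from a product decomposition of the graph *)

Theorem theorem3p20 (R : zd_family) (A B1 B2 : comPzRingType)
  (zetaA : graph_iso (zeta R A) (prod_graph (zeta R B1) (zeta R B2)))
  (zetaB1 : ~ graph_iso (zeta R B1) (zeta R zero_ring))
  (zetaB2 : ~ graph_iso (zeta R B2) (zeta R zero_ring)) :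
  exists (a1 a2 : A)
         (psi1 : zeta R B1 -> zeta R (ann_quot a1))
         (psi2 : zeta R B2 -> zeta R (ann_quot a2)),
    [/\
        [/\ orth a1 a2 /\ (nz_zero_divisor a1 /\ nz_zero_divisor a2),
            graph_iso (zeta R B1) (zeta_sub R (ann a2)) /\
              graph_iso (zeta R B2) (zeta_sub R (ann a1)) &
            strong_graph_morphism psi1 /\ strong_graph_morphism psi2],
        ((forall x x' : A, x \in ann a2 -> x' \in ann a2 ->
            R (ann_quot a1) (ann_proj a1 x) (ann_proj a1 x') -> R A x x') ->
          injective psi1) /\
        ((forall x x' : A, x \in ann a1 -> x' \in ann a1 ->
            R (ann_quot a2) (ann_proj a2 x) (ann_proj a2 x') -> R A x x') ->
          injective psi2) &
        ideal_sum (ann a1) (ann a2) = principal_ideal (1 : A) ->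
          [/\ ring_iso A (ann_quot a1 * ann_quot a2)%type,
              set_surj setT setT psi1 & set_surj setT setT psi2]].
Proof.
have [f [g [fK gK fM gM]]] := zetaA.
have adj_f x y : adj x y <-> prod_adj (f x) (f y).
  exact: iff_sym (graph_iso_adjE fK fM gM x y).
(* The second factor is the first one of the swapped product. *)
pose f' x := swap (f x); pose g' p := g (swap p).
have f'K : cancel f' g' by move=> x; rewrite /g' /f' /swap -surjective_pairing.
have g'K : cancel g' f' by case=> p q; rewrite /f' /g' gK.
have adj_f' x y : adj x y <-> prod_adj (f' x) (f' y).
  by rewrite adj_f; split=> -[].
have [a1 /esym ga1] := zeta_classP (g (zeta_class R 1, zeta_class R 0)).
have [a2 /esym ga2] := zeta_classP (g (zeta_class R 0, zeta_class R 1)).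
have ann1 c := @ann_coord2 _ _ _ _ f' g' g'K adj_f' a1 c ga1.
have ann2 c := ann_coord2 gK adj_f c ga2.
have ann12 c : c \in ann a1 -> c \in ann a2 -> c = 0.
  by move=> /ann1 c1 /ann2 c2; apply: coord_eq0 adj_f _ _ _.
have ann21 c : c \in ann a2 -> c \in ann a1 -> c = 0.
  by move=> c2 c1; apply: ann12.
have a12 : a1 * a2 = 0 by apply/eqP; rewrite -annE; apply/ann2; rewrite ga1 gK.
have a1nz : a1 != 0 := unit_coord2_neq0 g'K adj_f' zetaB1 ga1.
have a2nz : a2 != 0 := unit_coord2_neq0 gK adj_f zetaB2 ga2.
have strong1 := strong_axis1 gK adj_f.
have strong2 := strong_axis1 g'K adj_f'.
have inj1 := axis1_inj gK.
have inj2 := axis1_inj g'K.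
have im1 c := ann_axis1 fK gK adj_f c ga2.
have im2 c := @ann_axis1 _ _ _ _ f' g' f'K g'K adj_f' a1 c ga1.
exists a1, a2, (annihilator_proj a1 (axis1 g)), (annihilator_proj a2 (axis1 g')).
split; first split.
- split=> //; split; split=> //; first by exists a2.
  by exists a1; rewrite // mulrC.
- split; first exact: graph_iso_ann strong1 inj1 im1.
  exact: graph_iso_ann strong2 inj2 im2.
- split; first exact (strong_annihilator_proj ann12 strong1 im1).
  exact (strong_annihilator_proj ann21 strong2 im2).
- split; first exact: injective_annihilator_proj inj1 im1.
  exact: injective_annihilator_proj inj2 im2.
- move=> sum1; split; first exact: annihilator_crt sum1.
    exact: surjective_annihilator_proj im1 sum1.
  apply: surjective_annihilator_proj im2 _.
  rewrite -sum1 eqEsubset; split=> z [x [y [xa ya ->]]];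
    by exists y, x; rewrite addrC.
Qed.
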